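(* Assume that for every group $g\in\mathcal G$, $U_g(t_g^{\max})\ge U_g^\star>0$. For each $g\in\mathcal G$, let $\hat U_g^-(t,\alpha)$ be a point-wise lower confidence bound on $U_g(t)$, i.e. a random quantity with $\Pr\big(U_g(t)\ge \hat U_g^-(t,\alpha)\big)\ge 1-\alpha$ for every $t\in\{0,1,\dots,t_g^{\max}-1\}$ and every $\alpha\in(0,1)$. Define $$\hat t_g^{\mathrm{mono}} := \min\Big\{t\in\{1,\dots,t_g^{\max}-1\} : \hat U_g^-(t',\alpha)\ge U_g^\star \ \text{ for all integers } t' \text{ with } t\le t'<t_g^{\max}\Big\},$$ where the minimum over the empty set is defined to be $t_g^{\max}$. Then for any group $g\in\mathcal G$ and any $\alpha\in(0,1)$, with probability at least $1-\alpha$, $$U_g\big(\hat t_g^{\mathrm{mono}}\big)\ge U_g^\star .$$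
   Context: There are $n$ items $d^1,\dots,d^n$ in an item space $\mathcal D$, and a family $\mathcal G$ of (possibly overlapping) groups of items. A recommendation request is a pair $(q,\mathbf r)$ drawn from a distribution $P_{Q,\mathbf R}$, where $q\in\mathcal Q$ is a query and $\mathbf r=(r^1,\dots,r^n)\in\{0,1\}^n$ is the vector of relevances of the items. A relevance model $f:\mathcal Q\times\mathcal D\to[0,1]$ is fixed. For a query $q$ and group $g$, $\sigma_{q,g}^f$ is a deterministic ranking of the items of $g$ by decreasing value of $f(q,\cdot)$; $\sigma_{q,g}^f(j)$ is the index of the item of $g$ ranked at position $j$. For each $g$, $t_g^{\max}\ge 1$ is an integer (at most the number of items in $g$) and $U_g^\star\in\mathbb R$ is a target. For $t\in\{0,1,\dots,t_g^{\max}\}$, $$U_g(t):=\mathbb E_{(q,\mathbf r)\sim P_{Q,\mathbf R}}\Big[\sum_{j=1}^{t} r^{\sigma_{q,g}^f(j)}\Big]$$ is the expected number of relevant items among the $t$ top-scored items of $g$. In $U_g(\hat t)$ with $\hat t$ random, the deterministic function $U_g$ is evaluated at the random integer $\hat t$; probabilities are over the randomness of the confidence bounds (computed from random data). *)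

(* Defs.v *)
From mathcomp Require Import all_boot all_order all_algebra.
From mathcomp Require Import all_classical all_reals all_analysis.

Set Implicit Arguments.
Unset Strict Implicit.
Unset Printing Implicit Defensive.

Import Order.TTheory GRing.Theory Num.Theory.

Local Open Scope classical_set_scope.
Local Open Scope ring_scope.

(* Items are represented by their indices in 'I_n (d i is the i-th item), a
   group by a set of indices.  Positions are 0-based: s j is the index of the
   item at position j + 1 of the ranking.  Ties in the score may be broken
   arbitrarily. *)
Definition is_ranking (R : realType) (n : nat) (g : {set 'I_n})
    (score : 'I_n -> R) (s : 'I_#|g| -> 'I_n) : Prop :=
  [/\ injective s,
      (forall i : 'I_n, i \in g <-> exists j, s j = i) &
      (forall j k : 'I_#|g|, (j <= k)%N -> score (s k) <= score (s j))].

(* Makes the number of relevant items among the top t a random variable. *)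
Definition measurable_ranking (dQ : measure_display) (Q : measurableType dQ)
    (n m : nat) (s : Q -> 'I_m -> 'I_n) : Prop :=
  forall (j : 'I_m) (i : 'I_n), measurable [set q : Q | s q j = i].

(* The expectation of a bounded variable, kept in \bar R as in the library. *)
Definition expected_relevant (R : realType) (dQ : measure_display)
    (Q : measurableType dQ) (n m : nat)
    (P : probability (Q * n.-tuple bool)%type R)
    (s : Q -> 'I_m -> 'I_n) (t : nat) : \bar R :=
  'E_P[fun qr : Q * n.-tuple bool =>
         \sum_(j < m | (j < t)%N) (tnth qr.2 (s qr.1 j))%:R].

(* L t is the lower confidence bound at t.  Every candidate is < tmax, so the
   default value tmax is reached only when there is no candidate. *)
Definition t_mono (R : realType) (tmax : nat) (Ustar : R) (L : nat -> R) : nat :=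
  \big[minn/tmax]_(1 <= t < tmax |
      [forall t' : 'I_tmax, (t <= t')%N ==> (Ustar <= L t')]) t.

Definition pointwise_lower_confidence_bound (R : realType)
    (dW : measure_display) (W : measurableType dW) (Pr : probability W R)
    (tmax : nat) (U : nat -> \bar R) (Uhat : nat -> R -> {RV Pr >-> R}) : Prop :=
  forall (t : nat) (alpha : R), (t < tmax)%N -> 0 < alpha < 1 ->
    ((1 - alpha)%:E <= Pr [set w | (Uhat t alpha w)%:E <= U t])%E.

(* Main.v *)
(* U_g is nondecreasing in t with U_g(0) = 0 < Ustar <= U_g(tmax), so some
   s < tmax satisfies U_g(s) < Ustar <= U_g(s.+1), and the selected t is good
   exactly when s < t.  If t <= s then the lower bound at s is at least Ustar,
   that is, it exceeds U_g(s).  This one failure of the bound, at a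
   deterministic position, has probability at most alpha, so no union bound
   is needed. *)
Require Import Defs.
From mathcomp Require Import all_boot all_order all_algebra.
From mathcomp Require Import all_classical all_reals all_analysis.
From mathcomp Require Import measurable_realfun.

Set Implicit Arguments.
Unset Strict Implicit.
Unset Printing Implicit Defensive.

Import Order.TTheory GRing.Theory Num.Theory.

Local Open Scope classical_set_scope.
Local Open Scope ring_scope.

Lemma bigminn_leq (r : seq nat) (p : pred nat) (x y : nat) :
  (\big[minn/x]_(i <- r | p i) i <= y)%N =
  (x <= y)%N || has (fun i => p i && (i <= y)%N) r.
Proof.
elim: r => [|i r IH]; first by rewrite big_nil orbF.
rewrite big_cons /=; case: (p i) => //=.
by rewrite geq_min IH orbCA.
Qed.

(** The candidate condition passes from [t] to every larger index, so a positive [s] lies above some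
    candidate only if it is a candidate itself. Since [s < tmax], the default value of the minimum
    cannot account for the inequality. *)
Lemma t_mono_leq (R : realType) (tmax : nat) (Ustar : R) (L : nat -> R)
    (s : nat) : (s < tmax)%N ->
  (t_mono tmax Ustar L <= s)%N =
  (0 < s)%N && [forall t : 'I_tmax, (s <= t)%N ==> (Ustar <= L t)].
Proof.
move=> stmax; rewrite /t_mono bigminn_leq leqNgt stmax /=.
apply/hasP/andP => [[t] | [s_gt0 Ls]].
  rewrite mem_index_iota => /andP[t_gt0 _] /andP[/forallP Lt ts].
  split; first exact: leq_trans ts.
  by apply/forallP => t'; apply/implyP => /(leq_trans ts); apply/implyP.
by exists s; rewrite ?mem_index_iota ?s_gt0 // Ls leqnn.
Qed.

Lemma measurable_t_mono_gt (R : realType) (dW : measure_display)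
    (W : measurableType dW) (L : nat -> W -> R) (tmax : nat) (Ustar : R)
    (s : nat) : (forall t, measurable_fun setT (L t)) -> (s < tmax)%N ->
  measurable [set w | (s < t_mono tmax Ustar (L^~ w))%N].
Proof.
(* Candidates start at 1 and the default [tmax] is positive, so for [s = 0] the event is the whole
   space. *)
move=> mL stmax; case: (posnP s) => [->|s_gt0].
  rewrite (_ : [set _ | _] = setT) //; apply/seteqP; split => // w _ /=.
  by rewrite ltnNge t_mono_leq // (leq_ltn_trans _ stmax).
rewrite (_ : [set _ | _] = ~` \bigcap_(t in [set t | (s <= t < tmax)%N])
  (L t @^-1` `[Ustar, +oo[)).
  apply/measurableC/bigcap_measurable => [|t _].
    (* The intersection has to range over a nonempty set of indices; [s] is one of them. *)
    by exists s; rewrite /= leqnn.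
  by rewrite -[X in measurable X]setTI; exact: mL.
apply/seteqP; rewrite /bigcap; split => w /=;
  rewrite ltnNge t_mono_leq // s_gt0 /=.
  move=> /negP nL Lw; apply: nL; apply/forallP => t; apply/implyP => st.
  by have := Lw t; rewrite st ltn_ord in_itv /= andbT; apply.
move=> nL; apply/negP => /forallP Lw; apply: nL => t /andP[st ttmax].
by rewrite in_itv /= andbT; exact: (implyP (Lw (Ordinal ttmax))).
Qed.

Section expected_relevant.
Context (R : realType) (dQ : measure_display) (Q : measurableType dQ)
  (n m : nat) (P : probability (Q * n.-tuple bool)%type R).
Variable s : Q -> 'I_m -> 'I_n.

(** The coordinate that is read depends on the query. Splitting by the item [i] at position [j]
    turns the preimage of [true] into a finite union of measurable rectangles. *)
Lemma measurable_relevance (j : 'I_m) : measurable_ranking s ->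
  measurable_fun setT (fun qr : Q * n.-tuple bool => tnth qr.2 (s qr.1 j)).
Proof.
move=> ms; apply: (@measurable_fun_bool _ _ _ _ true); rewrite setTI.
rewrite (_ : _ @^-1` _ = \bigcup_(i in [set: 'I_n])
    ([set q | s q j = i] `*` ((@tnth _ bool)^~ i @^-1` [set true]))).
  apply: fin_bigcup_measurable => // i _; apply: measurableX; first exact: ms.
  by rewrite -[X in measurable X]setTI; exact: measurable_tnth.
apply/seteqP; split => [[q r] /= rq|[q r] [i _ [/= <-]] //].
by exists (s q j).
Qed.

Lemma expected_relevant0 : expected_relevant P s 0 = 0%E.
Proof.
rewrite /expected_relevant -[RHS](expectation_cst P 0).
by congr expectation; apply/funext => qr; rewrite big_pred0.
Qed.

Lemma le_expected_relevant : measurable_ranking s ->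
  {homo expected_relevant P s : t u / (t <= u)%N >-> (t <= u)%E}.
Proof.
move=> ms t u tu.
have mS k : measurable_fun setT (fun qr : Q * n.-tuple bool =>
    \sum_(j < m | (j < k)%N) (tnth qr.2 (s qr.1 j))%:R : R).
  under eq_fun do rewrite big_mkcond; apply: measurable_sum => j.
  case: (j < k)%N; last exact: measurable_cst.
  have mnat : measurable_fun setT (fun b : bool => b%:R : R) by [].
  exact: (measurableT_comp mnat (measurable_relevance j ms)).
rewrite /expected_relevant; apply: expectation_le => //.
- by move=> qr; apply: sumr_ge0.
- by move=> qr; apply: sumr_ge0.
- apply: aeW => qr; rewrite big_mkcond [leRHS]big_mkcond /=.
  apply: ler_sum => j _; case: ltnP => [jt|_]; last by case: ifP.
  by rewrite (leq_trans jt tu).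
Qed.

End expected_relevant.

Theorem theorem4p2 (R : realType)
  (n : nat) (D : Type) (d : 'I_n -> D)
  (G : Type) (items : G -> {set 'I_n})
  (dQ : measure_display) (Q : measurableType dQ)
  (P : probability (Q * n.-tuple bool)%type R)
  (f : Q -> D -> R)
  (f01 : forall q x, 0 <= f q x <= 1)
  (sigma : forall g : G, Q -> 'I_#|items g| -> 'I_n)
  (sigma_ranking : forall g q, is_ranking (fun i => f q (d i)) (sigma g q))
  (sigma_meas : forall g, measurable_ranking (sigma g))
  (tmax : G -> nat)
  (tmax_bounds : forall g, (1 <= tmax g <= #|items g|)%N)
  (Ustar : G -> R)
  (Ustar_gt0 : forall g, 0 < Ustar g)
  (Ustar_le : forall g,
     ((Ustar g)%:E <= expected_relevant P (sigma g) (tmax g))%E)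
  (dW : measure_display) (W : measurableType dW) (Pr : probability W R)
  (Uhat : G -> nat -> R -> {RV Pr >-> R})
  (Uhat_lcb : forall g, pointwise_lower_confidence_bound (tmax g)
     (expected_relevant P (sigma g)) (Uhat g))
  (g : G) (alpha : R) (alpha01 : 0 < alpha < 1) :
  ((1 - alpha)%:E <=
     Pr [set w : W |
       ((Ustar g)%:E <= expected_relevant P (sigma g)
          (t_mono (tmax g) (Ustar g) (fun t => Uhat g t alpha w)))%E])%E.
Proof.
set U := expected_relevant P (sigma g).
have Umono : {homo U : t u / (t <= u)%N >-> (t <= u)%E}.
  exact: le_expected_relevant.
have exU : exists t, ((Ustar g)%:E <= U t)%E by exists (tmax g).
(* The crossing index is the predecessor of the least [t] that reaches the target; that [t] is not 0
   because the target is positive. *)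
case: (ex_minnP exU) => -[|s].
  by rewrite /U expected_relevant0 lee_fin leNgt Ustar_gt0.
move=> Us1 min_s.
have stmax : (s < tmax g)%N by exact: min_s (Ustar_le g).
have Us : (U s < (Ustar g)%:E)%E.
  by rewrite ltNge; apply/negP => /min_s; rewrite ltnn.
(* Left to right is minimality of [s.+1], right to left is monotonicity of [U]. *)
have goodE t : ((Ustar g)%:E <= U t)%E = (s < t)%N.
  by apply/idP/idP => [/min_s //|/Umono]; exact: le_trans.
under eq_set do rewrite goodE.
apply: (le_trans (Uhat_lcb g s alpha stmax alpha01)); apply: le_measure.
(* [U s] is an extended real, so the event is read as the preimage of a ray under the bound cast to
   [\bar R]. *)
- rewrite inE (_ : [set _ | _] =
    (fun w => (Uhat g s alpha w)%:E) @^-1` `]-oo, U s]).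
    rewrite -[X in measurable X]setTI.
    have mU : measurable_fun setT (fun w => (Uhat g s alpha w : R)%:E).
      exact/measurable_EFinP.
    by apply: mU => //; exact: emeasurable_itv.
  by apply/seteqP; split => w /=; rewrite in_itv.
- by rewrite inE; apply: measurable_t_mono_gt.
(* The candidate condition for [s], taken at [s] itself, contradicts [lcb_s] and [Us]. *)
move=> w /= lcb_s; rewrite ltnNge t_mono_leq //; apply/negP => /andP[_ /forallP].
move=> /(_ (Ordinal stmax)); rewrite leqnn /= -lee_fin => /le_trans /(_ lcb_s).
by rewrite leNgt Us.
Qed.
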